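(* The theory $\mathbf{T}$ is not closed generic. In fact, no theory $\mathbf{T}^+$ with $\mathbf{T}^+\supseteq\mathbf{T}$ is closed generic.
   Context: Fix a nonempty set of symbols called propositional atoms and a symbol $\mathrm{K}$ which is not a propositional atom. Formulas are defined recursively: every propositional atom is a formula; if $\varphi,\psi$ are formulas then so are $\neg\varphi$, $(\varphi\wedge\psi)$, $(\varphi\vee\psi)$, $(\varphi\rightarrow\psi)$; if $\varphi$ is a formula then so is $\mathrm{K}(\varphi)$. A formula is basic if it is a propositional atom or of the form $\mathrm{K}\varphi$. A theory is a set of formulas. A model is a function assigning a truth value to every basic formula; truth $\mathscr M\models\varphi$ of an arbitrary formula is defined from the values of basic formulas by the classical truth tables (formulas $\mathrm{K}\varphi$ are treated like atoms). $\mathscr M\models T$ means $\mathscr M\models\varphi$ for all $\varphi\in T$; $T\models\varphi$ means every model of $T$ satisfies $\varphi$. A theory $T$ is closed if $\varphi\in T$ implies $\mathrm{K}\varphi\in T$. $\mathbf{T}$ is the set of all formulas of the form $\mathrm{K}\varphi\rightarrow\varphi$. For a theory $T$ and a set $S$ of propositional atoms, $\mathscr M_{T,S}$ is the model with $\mathscr M_{T,S}\models p$ iff $p\in S$ for atoms $p$, and $\mathscr M_{T,S}\models\mathrm{K}\varphi$ iff $T\models\varphi$. A theory $T$ is closed generic if for every set $S$ of propositional atoms and every closed theory $T'\supseteq T$, $\mathscr M_{T',S}\models T$. *)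

(* Defs.v *)
From Stdlib Require Export Ensembles.
From Stdlib Require Import ClassicalEpsilon.

Set Implicit Arguments.

Inductive formula (atom : Type) : Type :=
| Atom (p : atom)
| Neg (phi : formula atom)
| And (phi psi : formula atom)
| Or (phi psi : formula atom)
| Imp (phi psi : formula atom)
| Know (phi : formula atom).

Definition basic (atom : Type) (phi : formula atom) : Prop :=
  match phi with
  | Atom _ | Know _ => True
  | _ => False
  end.

Definition model (atom : Type) : Type := {phi : formula atom | basic phi} -> bool.

Fixpoint eval (atom : Type) (M : model atom) (phi : formula atom) : bool :=
  match phi with
  | Atom p => M (exist _ (Atom p) I)
  | Know psi => M (exist _ (Know psi) I)
  | Neg psi => negb (eval M psi)
  | And psi chi => andb (eval M psi) (eval M chi)
  | Or psi chi => orb (eval M psi) (eval M chi)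
  | Imp psi chi => implb (eval M psi) (eval M chi)
  end.

Definition satisfies (atom : Type) (M : model atom) (phi : formula atom) : Prop :=
  eval M phi = true.

Definition theory (atom : Type) : Type := Ensemble (formula atom).

Definition models (atom : Type) (M : model atom) (T : theory atom) : Prop :=
  forall phi : formula atom, In _ T phi -> satisfies M phi.

Definition entails (atom : Type) (T : theory atom) (phi : formula atom) : Prop :=
  forall M : model atom, models M T -> satisfies M phi.

Definition closed (atom : Type) (T : theory atom) : Prop :=
  forall phi : formula atom, In _ T phi -> In _ T (Know phi).

Definition axiomT (atom : Type) : theory atom :=
  fun psi => exists phi : formula atom, psi = Imp (Know phi) phi.
Arguments axiomT : clear implicits.

Definition truth_value (P : Prop) : bool :=
  if excluded_middle_informative P then true else false.

(* The last branch is never reached on a basic formula; the two lemmas below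
   characterize the model. *)
Definition canonical_model (atom : Type) (T : theory atom) (S : Ensemble atom) :
    model atom :=
  fun b => match proj1_sig b with
           | Atom p => truth_value (In _ S p)
           | Know phi => truth_value (entails T phi)
           | _ => false
           end.

Lemma truth_valueP (P : Prop) : truth_value P = true <-> P.
Proof.
  unfold truth_value.
  destruct (excluded_middle_informative P); split; intros; auto; easy.
Qed.

Lemma canonical_model_atom (atom : Type) (T : theory atom) (S : Ensemble atom)
    (p : atom) :
  satisfies (canonical_model T S) (Atom p) <-> In _ S p.
Proof. exact (truth_valueP _). Qed.

Lemma canonical_model_know (atom : Type) (T : theory atom) (S : Ensemble atom)
    (phi : formula atom) :
  satisfies (canonical_model T S) (Know phi) <-> entails T phi.
Proof. exact (truth_valueP _). Qed.

Definition closed_generic (atom : Type) (T : theory atom) : Prop :=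
  forall (S : Ensemble atom) (T' : theory atom),
    closed T' -> Included _ T T' -> models (canonical_model T' S) T.

(* Main.v *)
Require Import Defs.

(* The set of all formulas is a closed theory extending any theory, and it
   entails everything; so in its canonical model with no true atoms, [K p] holds
   while [p] fails. *)

(** Closed genericity quantifies over inconsistent closed extensions too. There everything is known,
    yet the truth of atoms is free to choose, so knowledge need not be factive and an instance of
    [axiomT] fails. *)

Lemma extension_of_axiomT_not_closed_generic (atom : Type)
    (atom_nonempty : inhabited atom) (Tplus : theory atom) :
  Included _ (axiomT atom) Tplus -> ~ closed_generic Tplus.
Proof.
  intros HT Hgen.
  destruct atom_nonempty as [p].
  set (M := canonical_model (Full_set (formula atom)) (Empty_set atom)).
  assert (HM : models M Tplus).
  (* Closedness and inclusion both reduce to membership in [Full_set]. *)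
  { apply Hgen; intros phi _; constructor. }
  assert (HK : satisfies M (Know (Atom p))).
  { apply canonical_model_know.
    (* [Atom p] is itself a member of [Full_set], hence entailed by it. *)
    intros N HN; apply HN; constructor. }
  assert (Himp : satisfies M (Imp (Know (Atom p)) (Atom p))).
  { apply HM, HT; exists (Atom p); reflexivity. }
  assert (Hp : satisfies M (Atom p)).
  { unfold satisfies in *; cbn [eval] in *.
    rewrite HK in Himp; exact Himp. }
  apply canonical_model_atom in Hp.
  destruct Hp.
Qed.

Theorem theorem27 (atom : Type) (atom_nonempty : inhabited atom) :
  ~ closed_generic (axiomT atom) /\
  (forall Tplus : theory atom,
     Included _ (axiomT atom) Tplus -> ~ closed_generic Tplus).
Proof.
  split.
  - apply extension_of_axiomT_not_closed_generic; [exact atom_nonempty |].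
    intros phi Hphi; exact Hphi.
  - intros Tplus; apply extension_of_axiomT_not_closed_generic; exact atom_nonempty.
Qed.
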